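(* Let $F:\{0,1\}^d\times\{0,1\}^d\to\{0,1\}$ and $n\in\mathbb{N}$. Suppose $F$ has a computationally-efficient $\Sigma_2^{\mathrm{cc}}$ protocol in which Merlin sends $m_1$ bits, Megan sends $m_2$ bits, and Alice and Bob communicate $\ell$ bits. Then there is a reduction from every $F\text{-}\mathsf{Satisfying\text{-}Pair}_n$ instance $I$ to $\mathsf{OV}_{n,2^{(m_2+\ell)}}$ instances $J_1,J_2,\dots,J_{2^{m_1}}$, such that $I$ is a yes instance if and only if there is a $j$ such that $J_j$ is a yes instance. The reduction takes $n\cdot2^{O(m_1+m_2+\ell)}\cdot\mathrm{poly}(d)$ time.
   Context: $F\text{-}\mathsf{Satisfying\text{-}Pair}_n$: given two sets $A,B$ of $n$ vectors from $\{0,1\}^d$, decide whether there is $(a,b)\in A\times B$ with $F(a,b)=1$. $\mathsf{OV}_{n,D}$: given two sets of $n$ vectors from $\{0,1\}^D$, decide whether some red-blue pair has inner product $0$. A $\Sigma_2^{\mathrm{cc}}$ protocol for $F:\mathcal{X}\times\mathcal{Y}\to\{0,1\}$: Alice holds $x\in\mathcal{X}$, Bob holds $y\in\mathcal{Y}$; prover Merlin sends a string $a\in\{0,1\}^{m_1}$ and prover Megan sends a string $b\in\{0,1\}^{m_2}$ (functions of both $x,y$) to both Alice and Bob; then Alice and Bob communicate $\ell$ bits and Alice decides to accept or reject $(a,b)$. It is required that $F(x,y)=1$ iff there exists $a$ such that for all $b$, Alice accepts $(a,b)$ after the communication with Bob. The protocol is computationally-efficient if Alice's and Bob's response functions are computable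 in time polynomial in their input length. *)

(* Defs.v *)
From mathcomp Require Import all_boot.

Set Implicit Arguments.
Unset Strict Implicit.
Unset Printing Implicit Defensive.

(** Programs act on finitely many registers (a program only mentions finitely
    many indices), each holding a bit string used as a stack.  Every elementary
    operation touches the top of one stack and costs 1, so each is a bounded
    number of steps of a multi-tape Turing machine; conversely two stacks
    simulate a tape, with the state kept in the control flow and in stacks of
    bounded height.  Running times thus agree with those of multi-tape Turing
    machines up to a constant factor. *)

Definition store := nat -> seq bool.

Definition upd (s : store) (r : nat) (w : seq bool) : store :=
  fun q => if q == r then w else s q.

Inductive cmd :=
| Skip
| Push of nat & bool
| Pop of nat
| Seq of cmd & cmd
(* [Branch r c1 c0 ce]: top of [r] is 1, top of [r] is 0, [r] is empty *)
| Branch of nat & cmd & cmd & cmd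
(* [While r c]: as long as [r] is nonempty *)
| While of nat & cmd.

Inductive exec : cmd -> store -> nat -> store -> Prop :=
| ExecSkip s : exec Skip s 1 s
| ExecPush r b s : exec (Push r b) s 1 (upd s r (b :: s r))
| ExecPop r s : exec (Pop r) s 1 (upd s r (behead (s r)))
| ExecSeq c1 c2 s s1 s2 t1 t2 :
    exec c1 s t1 s1 -> exec c2 s1 t2 s2 -> exec (Seq c1 c2) s (t1 + t2) s2
| ExecBranch r c1 c0 ce s s' t :
    exec (match s r with
          | [::] => ce
          | true :: _ => c1
          | false :: _ => c0
          end) s t s' ->
    exec (Branch r c1 c0 ce) s t.+1 s'
| ExecWhileEnd r c s : s r = [::] -> exec (While r c) s 1 s
| ExecWhileStep r c s s1 s2 t1 t2 :
    s r <> [::] -> exec c s t1 s1 -> exec (While r c) s1 t2 s2 ->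
    exec (While r c) s (t1 + t2).+1 s2.

(** [runs c inp T out]: with the strings [inp] in registers 0, 1, ... and all
    other registers empty, [c] halts within [T] steps with the strings [out]
    in registers 0, 1, ...  The remaining registers are unconstrained. *)
Definition runs (c : cmd) (inp : seq (seq bool)) (T : nat)
    (out : seq (seq bool)) : Prop :=
  exists t s, [/\ t <= T, exec c (nth [::] inp) t s
    & forall r, r < size out -> s r = nth [::] out r].

(** Every polynomial in the total input length [N] is at most [k * (N + 1) ^ k]
    for some [k]. *)
Definition runs_poly (c : cmd) (k : nat) (inp out : seq (seq bool)) : Prop :=
  runs c inp (k * (sumn (map size inp)).+1 ^ k) out.

Definition unary (k : nat) : seq bool := nseq k true.

(** A pair of families of [n] vectors from {0,1}^d; repetitions are allowed. *)
Definition instance (n d : nat) : Type :=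
  (n.-tuple (d.-tuple bool) * n.-tuple (d.-tuple bool))%type.

Definition satisfying_pair (n d : nat)
    (F : d.-tuple bool -> d.-tuple bool -> bool) (I : instance n d) : Prop :=
  exists a b, [/\ a \in I.1, b \in I.2 & F a b].

Definition inner (D : nat) (u v : D.-tuple bool) : nat :=
  \sum_(i < D) tnth u i * tnth v i.

Definition OV (n D : nat) (J : instance n D) : Prop :=
  satisfying_pair (fun u v => inner u v == 0) J.

(** The [n * d] bits of a list of [n] vectors, one vector after the other. *)
Definition bits (d : nat) (A : seq (d.-tuple bool)) : seq bool :=
  flatten (map val A).

(** A response function maps the party's own input, the two proofs and the bits
    exchanged so far (oldest first) to the bit the party sends, or to [None]
    when it is the other party's turn. *)
Record protocol (d m1 m2 l : nat) := Protocol {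
  alice : d.-tuple bool -> m1.-tuple bool -> m2.-tuple bool -> seq bool ->
    option bool;
  bob : d.-tuple bool -> m1.-tuple bool -> m2.-tuple bool -> seq bool ->
    option bool;
  verdict : d.-tuple bool -> m1.-tuple bool -> m2.-tuple bool -> seq bool ->
    bool;
  one_speaker : forall x y a b t, size t < l ->
    isSome (bob y a b t) = ~~ isSome (alice x a b t)
}.

Section Protocol.
Variables (d m1 m2 l : nat) (P : protocol d m1 m2 l).

Fixpoint transcript (x y : d.-tuple bool) (a : m1.-tuple bool)
    (b : m2.-tuple bool) (k : nat) : seq bool :=
  if k is k'.+1 then
    let t := transcript x y a b k' in
    match alice P x a b t, bob P y a b t with
    | Some c, _ | None, Some c => rcons t c
    | None, None => t
    end
  else [::].

Definition accepts x y a b : bool := verdict P x a b (transcript x y a b l).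

Definition sigma2_computes (F : d.-tuple bool -> d.-tuple bool -> bool) : Prop :=
  forall x y, F x y <-> exists a, forall b, accepts x y a b.

End Protocol.

Definition seq_of_response (o : option bool) : seq bool :=
  if o is Some c then [:: c] else [::].

(** Polynomial time is a property of a family of protocols: one program per
    response function, and one polynomial, have to serve all members.  The
    parties know the number [l] of bits to be exchanged. *)
Definition efficient (idx : Type) (d m1 m2 l : idx -> nat)
    (P : forall i, protocol (d i) (m1 i) (m2 i) (l i)) : Prop :=
  exists (cA cB cV : cmd) (k : nat),
  forall i (z : (d i).-tuple bool) (a : (m1 i).-tuple bool)
    (b : (m2 i).-tuple bool) (t : seq bool),
  let inp := [:: val z; val a; val b; t; unary (l i)] in
  (size t < l i ->
     runs_poly cA k inp [:: seq_of_response (alice (P i) z a b t)] /\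
     runs_poly cB k inp [:: seq_of_response (bob (P i) z a b t)]) /\
  (size t = l i -> runs_poly cV k inp [:: [:: verdict (P i) z a b t]]).

Definition reduction_input (n d m1 m2 l : nat) (I : instance n d) :
    seq (seq bool) :=
  [:: bits I.1; bits I.2; unary n; unary d; unary m1; unary m2; unary l].

(** The red sides of all instances one after the other, and likewise the blue
    sides. *)
Definition reduction_output (N n D : nat) (J : N.-tuple (instance n D)) :
    seq (seq bool) :=
  [:: flatten [seq bits K.1 | K : instance n D <- J];
      flatten [seq bits K.2 | K : instance n D <- J]].

(* Main.v *)
Require Import Defs.
From mathcomp Require Import all_boot.
From mathcomp Require Import zify.

(* For a proof string [a] of Merlin, index coordinates by pairs (b, t) of a
   string of Megan and a candidate transcript.  The vector of [x] has a 1 at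
   (b, t) iff [t] agrees with every bit Alice would send along [t] and she then
   rejects; the vector of [y] has a 1 iff [t] agrees with every bit Bob would
   send along [t].  As exactly one party speaks at a time, both agree with [t]
   only if [t] is the transcript, so the inner product counts the [b] rejected
   on (x, y, a), and it vanishes iff [a] convinces Alice.  The reduction
   enumerates a, the input vectors, b and t in nested loops and simulates the
   response functions on each. *)

Set Implicit Arguments.
Unset Strict Implicit.
Unset Printing Implicit Defensive.

(** * Execution up to pointwise equality of stores *)

(** A party's bit at (b, t) depends on its own vector alone, so each side is computed without ever
    pairing vectors; this keeps the time linear in [n]. [efficient] bounds the response programs on
    every string [t] of admissible length, real transcript or not, so they can be run along all
    candidates. They are arbitrary commands that expect a fresh machine and leave garbage behind.
    Hence they are shifted to a block of registers that is filled with copies before each call and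
    emptied after it; this is affordable because [T] steps lengthen a stack by at most [T]. [While]
    can only consume its counter, so every loop must give back what it used up. The enumerations
    start from all-ones strings, which are exactly the unary inputs [m1], [m2], [l]; they count down
    and wrap around to the same string. Nesting rests on one invariant: the net effect of a block is
    to push its output on register 0. Stores are functions, and commuting updates give only
    pointwise equal ones; hence [run] in place of [exec]. *)

Definition run (c : cmd) (s : store) (T : nat) (s' : store) : Prop :=
  exists t s1, [/\ t <= T, exec c s t s1 & s1 =1 s'].

Lemma upd_ext s1 s2 r w1 w2 : s1 =1 s2 -> w1 = w2 -> upd s1 r w1 =1 upd s2 r w2.
Proof. by move=> e -> q; rewrite /upd e. Qed.

Lemma exec_ext c s t s' : exec c s t s' -> forall s2, s =1 s2 ->
  exists2 s2', exec c s2 t s2' & s' =1 s2'.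
Proof.
elim=> {c s t s'} [s|r b s|r s|c1 c2 s s1 s2 t1 t2 _ IH1 _ IH2
  |r c1 c0 ce s s' t _ IH|r c s e|r c s s1 s2 t1 t2 e _ IH1 _ IH2] s0 E.
- by exists s0 => //; constructor.
- by exists (upd s0 r (b :: s0 r)); [constructor|apply: upd_ext; rewrite ?E].
- by exists (upd s0 r (behead (s0 r))); [constructor|apply: upd_ext; rewrite ?E].
- have [s3 h3 /IH2 [s4 h4 E4]] := IH1 _ E.
  by exists s4 => //; apply: ExecSeq h3 h4.
- have [s3 h3 E3] := IH _ E.
  by exists s3 => //; apply: ExecBranch; rewrite -E.
- by exists s0 => //; apply: ExecWhileEnd; rewrite -E.
- have [s3 h3 /IH2 [s4 h4 E4]] := IH1 _ E.
  by exists s4 => //; apply: ExecWhileStep h3 h4; rewrite -E.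
Qed.

(** A step lengthens at most one stack, by one bit. This bounds the garbage left by a response
    program and the length of the reduction's output. *)
Lemma exec_size c s t s' r : exec c s t s' -> size (s' r) <= size (s r) + t.
Proof.
elim=> {c s t s'} [s|q b s|q s|c1 c2 s s1 s2 t1 t2 _ IH1 _ IH2
  |q c1 c0 ce s s' t _ IH|q c s e|q c s s1 s2 t1 t2 e _ IH1 _ IH2]; try lia.
- by rewrite /upd; case: eqP => [->|_] /=; lia.
- by rewrite /upd; case: eqP => [->|_]; rewrite ?size_behead; lia.
Qed.

Lemma run_sub c s T s' s0 T0 s0' :
  run c s0 T0 s0' -> s0 =1 s -> T0 <= T -> s0' =1 s' -> run c s T s'.
Proof.
move=> [t [s1 [le e E]]] Es leT E'.
have [s2 h2 E2] := exec_ext e Es.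
exists t, s2; split => //; first by apply: leq_trans leT.
by move=> q; rewrite -E2 E E'.
Qed.

Lemma run_post c s T s' T0 s0' :
  run c s T0 s0' -> T0 <= T -> s0' =1 s' -> run c s T s'.
Proof. by move=> h; apply: run_sub h _. Qed.

Lemma run_skip s : run Skip s 1 s.
Proof. by exists 1, s; split => //; constructor. Qed.

Lemma run_push r b s : run (Push r b) s 1 (upd s r (b :: s r)).
Proof. by eexists 1, _; split => //; constructor. Qed.

Lemma run_pop r s : run (Pop r) s 1 (upd s r (behead (s r))).
Proof. by eexists 1, _; split => //; constructor. Qed.

Lemma run_seq c1 c2 s s1 s2 T1 T2 :
  run c1 s T1 s1 -> run c2 s1 T2 s2 -> run (Seq c1 c2) s (T1 + T2) s2.
Proof.
move=> [t1 [s3 [le1 e1 E1]]] [t2 [s4 [le2 e2 E2]]].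
have [s5 h5 E5] := exec_ext e2 (fun q => esym (E1 q)).
exists (t1 + t2), s5; split; [lia|exact: ExecSeq e1 h5|].
by move=> q; rewrite -E5.
Qed.

Lemma run_branch r c1 c0 ce s s' T :
  run (match s r with [::] => ce | true :: _ => c1 | false :: _ => c0 end) s T s' ->
  run (Branch r c1 c0 ce) s T.+1 s'.
Proof. by move=> [t [s1 [le e E]]]; exists t.+1, s1; split => //; constructor. Qed.

Lemma run_while_end r c s : s r = [::] -> run (While r c) s 1 s.
Proof. by move=> e; exists 1, s; split => //; constructor. Qed.

Lemma run_while_step r c s s1 s2 T1 T2 :
  s r <> [::] -> run c s T1 s1 -> run (While r c) s1 T2 s2 ->
  run (While r c) s (T1 + T2).+1 s2.
Proof.
move=> ne [t1 [s3 [le1 e1 E1]]] [t2 [s4 [le2 e2 E2]]].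
have [s5 h5 E5] := exec_ext e2 (fun q => esym (E1 q)).
exists (t1 + t2).+1, s5; split; [lia|exact: ExecWhileStep ne e1 h5|].
by move=> q; rewrite -E5.
Qed.

Lemma run_while r c (S : nat -> store) T m :
  (forall i, i < m -> S i r <> [::] /\ run c (S i) T (S i.+1)) ->
  S m r = [::] -> run (While r c) (S 0) (m * T.+1).+1 (S m).
Proof.
elim: m S => [|m IH] S h e; first exact: run_while_end.
have [ne h0] := h 0 isT.
have h1 := IH (fun i => S i.+1) (fun i lt => h i.+1 lt) e.
by apply: run_post (run_while_step ne h0 h1) _ _ => //; lia.
Qed.

(** * Moving programs to fresh registers *)

Fixpoint regs (c : cmd) : nat :=
  match c with
  | Skip => 0
  | Push r _ => r.+1
  | Pop r => r.+1
  | Seq c1 c2 => maxn (regs c1) (regs c2)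
  | Branch r c1 c0 ce => maxn r.+1 (maxn (regs c1) (maxn (regs c0) (regs ce)))
  | While r c => maxn r.+1 (regs c)
  end.

Fixpoint shift (K : nat) (c : cmd) : cmd :=
  match c with
  | Skip => Skip
  | Push r b => Push (K + r) b
  | Pop r => Pop (K + r)
  | Seq c1 c2 => Seq (shift K c1) (shift K c2)
  | Branch r c1 c0 ce => Branch (K + r) (shift K c1) (shift K c0) (shift K ce)
  | While r c => While (K + r) (shift K c)
  end.

(* Registers [K], ..., [K + B - 1] simulate registers 0, ..., [B - 1] of [s']. *)
Definition graft (K B : nat) (s' s : store) : store :=
  fun q => if K <= q < K + B then s' (q - K) else s q.

Lemma graft_in K B s' s r : r < B -> graft K B s' s (K + r) = s' r.
Proof. by move=> h; rewrite /graft leq_addr ltn_add2l h addKn. Qed.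

Lemma graft_upd K B s' s r w : r < B ->
  upd (graft K B s' s) (K + r) w =1 graft K B (upd s' r w) s.
Proof.
move=> h q; rewrite /upd /graft; case: (q =P K + r) => [->|ne].
  by rewrite leq_addr ltn_add2l h addKn eqxx.
by case: ifP => // ?; case: eqP => // ?; exfalso; lia.
Qed.

(** [B] may exceed [regs c]: the block has to contain the five input registers even if [c] does not
    mention them all. *)
Lemma run_shift K B c s t s' s0 : exec c s t s' -> regs c <= B ->
  run (shift K c) (graft K B s s0) t (graft K B s' s0).
Proof.
move=> e; elim: e s0 => {c s t s'} [s|r b s|r s|c1 c2 s s1 s2 t1 t2 _ IH1 _ IH2
  |r c1 c0 ce s s' t _ IH|r c s e|r c s s1 s2 t1 t2 e _ IH1 _ IH2] s0 /= h.
- exact: run_skip.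
- by apply: run_post (run_push _ _ _) _ _ => //; rewrite graft_in //; apply: graft_upd.
- by apply: run_post (run_pop _ _) _ _ => //; rewrite graft_in //; apply: graft_upd.
- by apply: run_seq (IH1 _ _) (IH2 _ _); lia.
- apply: run_branch; rewrite graft_in; last by lia.
  by case: (s r) IH => [|[] u] IH; apply: IH; lia.
- by apply: run_while_end; rewrite graft_in //; lia.
- by apply: run_while_step (IH1 _ _) (IH2 _ _); rewrite ?graft_in //; lia.
Qed.

(** * Moving, copying and clearing stacks *)

Ltac store_eq :=
  let q := fresh "q" in
  move=> q; rewrite /upd /=;
  repeat (case: eqP => ?; try subst q; rewrite ?eqxx //=; try (exfalso; lia));
  try congruence.

Definition move1 (r q : nat) : cmd :=
  Branch r (Seq (Pop r) (Push q true)) (Seq (Pop r) (Push q false)) Skip.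

Lemma run_move1 (r q : nat) s b w : q != r -> s r = b :: w ->
  run (move1 r q) s 3 (upd (upd s r w) q (b :: s q)).
Proof.
move=> ne e; apply: run_branch; rewrite e.
have hp := run_pop r s; rewrite e /= in hp.
by case: b e => e; apply: run_post (run_seq hp (run_push _ _ _)) _ _ => //; store_eq.
Qed.

Definition move (r q : nat) : cmd := While r (move1 r q).

Lemma run_move (r q : nat) s : q != r ->
  run (move r q) s (4 * size (s r)).+1 (upd (upd s r [::]) q (catrev (s r) (s q))).
Proof.
move=> ne; move e: (s r) => w; elim: w s e => [|b w IH] s e.
  by apply: run_post (run_while_end _ e) _ _ => //; store_eq.
have h := run_move1 ne e.
have er : upd (upd s r w) q (b :: s q) r = w.
  by rewrite /upd eq_sym (negbTE ne) eqxx.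
apply: run_post (run_while_step _ h (IH _ er)) _ _ => /=; rewrite ?e //; try lia.
by store_eq.
Qed.

Definition move2 (r q1 q2 : nat) : cmd :=
  While r (Branch r (Seq (Pop r) (Seq (Push q1 true) (Push q2 true)))
                    (Seq (Pop r) (Seq (Push q1 false) (Push q2 false))) Skip).

Lemma run_move2 (r q1 q2 : nat) s : q1 != r -> q2 != r -> q1 != q2 ->
  run (move2 r q1 q2) s (5 * size (s r)).+1
    (upd (upd (upd s r [::]) q1 (catrev (s r) (s q1))) q2 (catrev (s r) (s q2))).
Proof.
move=> n1 n2 n12; move e: (s r) => w; elim: w s e => [|b w IH] s e.
  by apply: run_post (run_while_end _ e) _ _ => //; store_eq.
set s1 := upd (upd (upd s r w) q1 (b :: s q1)) q2 (b :: s q2).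
have er : s1 r = w.
  by rewrite /s1 /upd eq_sym (negbTE n2) eq_sym (negbTE n1) eqxx.
have h : run (Branch r (Seq (Pop r) (Seq (Push q1 true) (Push q2 true)))
               (Seq (Pop r) (Seq (Push q1 false) (Push q2 false))) Skip) s 4 s1.
  apply: run_branch; rewrite e.
  have hp := run_pop r s; rewrite e /= in hp.
  case: b @s1 {e er} => s1;
    apply: run_post (run_seq hp (run_seq (run_push _ _ _) (run_push _ _ _))) _ _ => //;
    by rewrite /s1; store_eq.
apply: run_post (run_while_step _ h (IH _ er)) _ _ => /=; rewrite ?e //; try lia.
by rewrite /s1; store_eq.
Qed.

(** A move reverses a stack; two in a row preserve its order, and the second one also refills the
    source. *)
Definition copy (r q tmp : nat) : cmd := Seq (move r tmp) (move2 tmp r q).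

Lemma run_copy (r q tmp : nat) s : tmp != r -> tmp != q -> q != r -> s tmp = [::] ->
  run (copy r q tmp) s (9 * size (s r) + 2) (upd s q (s r ++ s q)).
Proof.
move=> n1 n2 n3 e.
have [n4 n5] : r != tmp /\ q != tmp by rewrite !(eq_sym _ tmp).
apply: run_post (run_seq (run_move s n1) (run_move2 _ n4 n5 _)) _ _.
- by rewrite eq_sym.
- by rewrite {1}/upd eqxx e -/(rev _) size_rev; lia.
have rcat (u v : seq bool) : catrev (rev u) v = u ++ v by rewrite catrevE revK.
by store_eq; rewrite ?e -?/(rev _) ?rcat ?cats0 ?revK.
Qed.

(** Only the source is turned back. This suits the transcript prefix, which is kept with its newest
    bit on top, while the programs expect the oldest bit first. *)
Definition rev_copy (r q tmp : nat) : cmd := Seq (move2 r tmp q) (move tmp r).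

Lemma run_rev_copy (r q tmp : nat) s : tmp != r -> tmp != q -> q != r -> s tmp = [::] ->
  run (rev_copy r q tmp) s (9 * size (s r) + 2) (upd s q (rev (s r) ++ s q)).
Proof.
move=> n1 n2 n3 e.
have n4 : r != tmp by rewrite eq_sym.
apply: run_post (run_seq (run_move2 s n1 n3 n2) (run_move _ n4)) _ _.
  by rewrite {1}/upd (negbTE n2) {1}/upd eqxx e -/(rev _) size_rev; lia.
by store_eq; rewrite ?e -?/(rev _) ?catrevE ?revK ?cats0.
Qed.

Definition clear (r : nat) : cmd := While r (Pop r).

Lemma run_clear r s : run (clear r) s (2 * size (s r)).+1 (upd s r [::]).
Proof.
move e: (s r) => w; elim: w s e => [|b w IH] s e.
  by apply: run_post (run_while_end _ e) _ _ => //; store_eq.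
have hp := run_pop r s; rewrite e /= in hp.
have er : upd s r w r = w by rewrite /upd eqxx.
apply: run_post (run_while_step _ hp (IH _ er)) _ _ => /=; rewrite ?e //; try lia.
by store_eq.
Qed.

Fixpoint clear_from (K B : nat) : cmd :=
  if B is B'.+1 then Seq (clear K) (clear_from K.+1 B') else Skip.

Lemma run_clear_from K B M s :
  (forall q, K <= q < K + B -> size (s q) <= M) ->
  run (clear_from K B) s (B * (2 * M).+1).+1
    (fun q => if K <= q < K + B then [::] else s q).
Proof.
elim: B K s => [|B IH] K s h.
  apply: run_post (run_skip _) _ _ => //.
  by move=> q; case: ifP => //; lia.
apply: run_post (run_seq (run_clear _ _) (IH _ _ _)) _ _.
- move=> q hq; rewrite /upd; case: eqP => // _; apply: h; lia.
- have := h K; rewrite mulSn; lia.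
- move=> q; rewrite /upd; case: (q =P K) => [->|ne].
    by case: ifP => //; case: ifP => //; lia.
  by case: ifP; case: ifP => //; lia.
Qed.

(** * The reduction program *)

(* Registers: 0 emitted bits; 1 blue input; 2 n; 3 d; 4 a; 5 b; 6 l; 7 t;
   8 vectors still to be read; 9 saved red output; 11, 16 loop counters already
   consumed; 12 vectors already read; 13 current vector; 10, 14, 15 nonempty
   while the loops over a, b, t go on; 17 reversed transcript prefix;
   18 response; 19 borrow; 20 temporary; 21 and up the simulated program.
   Inner loops use higher scratch registers than outer ones, so what a block
   needs to find empty is a final segment of the registers. *)
Definition free (k : nat) (s : store) : Prop := forall q, k <= q -> s q = [::].

Definition call (c : cmd) : cmd :=
  Seq (rev_copy 17 24 20) (Seq (copy 13 21 20) (Seq (copy 4 22 20)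
  (Seq (copy 5 23 20) (Seq (copy 6 25 20) (Seq (shift 21 c)
  (Seq (move 21 18) (clear_from 21 (maxn 5 (regs c))))))))).

(** Five copies at 9 steps per bit and the run itself fit into the 60; emptying the block takes 2
    steps per bit in each register. *)
Definition call_cost (c : cmd) (M : nat) : nat :=
  (60 + 2 * maxn 5 (regs c)) * M.+1.

Lemma run_call c N T s p out : free 18 s -> s 17 = rev p ->
  runs c [:: s 13; s 4; s 5; p; s 6] T [:: out] -> size out <= 1 ->
  size (s 13) + size (s 4) + size (s 5) + size p + size (s 6) <= N ->
  run (call c) s (call_cost c (N + T)) (upd s 18 out).
Proof.
move=> fr ep [t [s' [let_ ex es']]] szo szN.
have e0 : s' 0 = out by apply: es'.
have E q : 18 <= q -> s q = [::] := fr q.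
set B := maxn 5 (regs c).
set inp := [:: s 13; s 4; s 5; p; s 6] in ex *.
have h1 : run (rev_copy 17 24 20) s (9 * N + 2) (upd s 24 p).
  apply: run_post (@run_rev_copy 17 24 20 s _ _ _ _) _ _ => //; first by rewrite E.
  - by rewrite ep size_rev; lia.
  - by rewrite ep revK E // cats0.
have h2 : run (copy 13 21 20) (upd s 24 p) (9 * N + 2) (upd (upd s 24 p) 21 (s 13)).
  apply: run_post (@run_copy 13 21 20 _ _ _ _ _) _ _ => //; first by rewrite /upd /= E.
  - by rewrite /upd /=; lia.
  - by apply: upd_ext => //; rewrite /upd /= (E 21) // cats0.
set s2 := upd _ 21 _ in h2.
have h3 : run (copy 4 22 20) s2 (9 * N + 2) (upd s2 22 (s 4)).
  apply: run_post (@run_copy 4 22 20 _ _ _ _ _) _ _ => //; first by rewrite /s2 /upd /= E.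
  - by rewrite /s2 /upd /=; lia.
  - by apply: upd_ext => //; rewrite /s2 /upd /= (E 22) // cats0.
set s3 := upd s2 22 _ in h3.
have h4 : run (copy 5 23 20) s3 (9 * N + 2) (upd s3 23 (s 5)).
  apply: run_post (@run_copy 5 23 20 _ _ _ _ _) _ _ => //; first by rewrite /s3 /s2 /upd /= E.
  - by rewrite /s3 /s2 /upd /=; lia.
  - by apply: upd_ext => //; rewrite /s3 /s2 /upd /= (E 23) // cats0.
set s4 := upd s3 23 _ in h4.
have h5 : run (copy 6 25 20) s4 (9 * N + 2) (upd s4 25 (s 6)).
  apply: run_post (@run_copy 6 25 20 _ _ _ _ _) _ _ => //.
  - by rewrite /s4 /s3 /s2 /upd /= E.
  - by rewrite /s4 /s3 /s2 /upd /=; lia.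
  - by apply: upd_ext => //; rewrite /s4 /s3 /s2 /upd /= (E 25) // cats0.
set s5 := upd s4 25 _ in h5.
(* To the shifted program the block looks like a fresh machine: its first five registers hold the
   inputs and the rest is empty by [free 18]. *)
have E5 : graft 21 B (nth [::] inp) s =1 s5.
  move=> q; case: (ltnP q 26) => [lt|ge].
    have hB : 5 <= B by apply: leq_maxl.
    rewrite /s5 /s4 /s3 /s2 /upd /graft; case: ifP => h.
      have : q \in iota 21 5 by rewrite mem_iota; lia.
      by rewrite !inE => /orP [|/or4P []] /eqP ->.
    by do 21 (case: q h lt => [//|q] h lt); lia.
  have -> : s5 q = [::].
    rewrite /s5 /s4 /s3 /s2 /upd; do 5 (case: eqP => [?|_]; first by lia).
    by apply: E; lia.
  by rewrite /graft; case: ifP => _; [rewrite nth_default //=; lia|apply: E; lia].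
have h6 : run (shift 21 c) s5 T (graft 21 B s' s).
  apply: run_sub (@run_shift 21 B c _ _ _ s ex (leq_maxr _ _)) E5 let_ _ => //.
set s6 := graft 21 B s' s in h6.
have e6 : s6 21 = out by rewrite -e0; apply: (@graft_in 21 B s' s 0); lia.
(* The move reverses the answer, which is harmless for a string of length at most one. *)
have h7 : run (move 21 18) s6 5 (upd (upd s6 21 [::]) 18 out).
  apply: run_post (@run_move 21 18 _ _) _ _ => //; first by rewrite e6; lia.
  apply: upd_ext => //; rewrite e6 /s6 /graft /= E //.
  by case: out szo {es' e0 e6} => [|b []].
apply: run_post (run_seq h1 (run_seq h2 (run_seq h3 (run_seq h4 (run_seq h5
  (run_seq h6 (run_seq h7 (@run_clear_from _ _ (N + T) _ _)))))))) _ _.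
(* What the program left in its block is unknown, but each stack holds at most its initial length
   plus the running time. *)
- move=> q hq; rewrite /upd; case: eqP => [?|_]; first by lia.
  case: eqP => // _; rewrite /s6 /graft hq.
  apply: leq_trans (exec_size _ ex) _; rewrite leq_add //.
  apply: leq_trans szN; rewrite /inp.
  by case: (q - 21) => [|[|[|[|[|r]]]]] /=; rewrite ?nth_nil /=; lia.
- by rewrite /call_cost -/B; nia.
- move=> q; case: ifP => hq; rewrite /upd.
    by case: eqP => [?|_]; [lia|rewrite E //; lia].
  by case: eqP => // _; case: eqP => [?|_]; [lia|rewrite /s6 /graft hq].
Qed.

(** * Computing one coordinate *)

Definition emits (c : cmd) (s : store) (T : nat) (w : seq bool) : Prop :=
  run c s T (upd s 0 (w ++ s 0)).

(** On [None] the bit is the other party's to send, so it cannot be wrong. *)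
Definition agrees (o : option bool) (e : bool) : bool :=
  if o is Some e' then e' == e else true.

Fixpoint consistent (f : seq bool -> option bool) (p r : seq bool) : bool :=
  if r is e :: r' then agrees (f p) e && consistent f (rcons p e) r' else true.

(** The coordinate is pushed as 1 beforehand and overwritten on failure; the loop does not stop
    early, so the string in register 7 is always consumed completely and can be restored. *)
Definition reject : cmd := Seq (Pop 0) (Push 0 false).

Lemma run_reject s e o : s 0 = e :: o -> run reject s 2 (upd s 0 (false :: o)).
Proof.
move=> e0; apply: run_post (run_seq (run_pop _ _) (run_push _ _ _)) _ _ => //.
by store_eq; rewrite e0.
Qed.

Definition check_step (c : cmd) : cmd :=
  Seq (call c) (Seq (Branch 18 (Branch 7 Skip reject Skip)
                               (Branch 7 reject Skip Skip) Skip)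
                    (Seq (Pop 18) (move1 7 17))).

Lemma run_check_step c N T s p r e ok o (q : option bool) :
  free 18 s -> s 17 = rev p -> s 7 = e :: r -> s 0 = ok :: o ->
  runs c [:: s 13; s 4; s 5; p; s 6] T [:: seq_of_response q] ->
  size (s 13) + size (s 4) + size (s 5) + size p + size (s 6) <= N ->
  run (check_step c) s (call_cost c (N + T) + 8)
    (upd (upd (upd s 0 ((ok && agrees q e) :: o)) 7 r) 17 (rev (rcons p e))).
Proof.
move=> fr ep er eo hr hN.
have szq : size (seq_of_response q) <= 1 by case: (q).
have h1 := run_call fr ep hr szq hN.
set s1 := upd s 18 _ in h1.
pose s2 := upd s1 0 ((ok && agrees q e) :: o).
have h2 : run (Branch 18 (Branch 7 Skip reject Skip)
                  (Branch 7 reject Skip Skip) Skip) s1 4 s2.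
  have skip : (ok && agrees q e) = ok -> run Skip s1 2 s2.
    move=> h; apply: run_post (run_skip _) _ _ => //; rewrite /s2 h.
    by rewrite /s1; store_eq.
  have rej : (ok && agrees q e) = false -> run reject s1 2 s2.
    move=> h; rewrite /s2 h; apply: (@run_reject s1 ok o).
    by rewrite /s1 /upd /= eo.
  apply: run_branch.
  have -> : s1 18 = seq_of_response q by [].
  have e7 : s1 7 = e :: r by rewrite /s1 /upd /=.
  rewrite /agrees in skip rej.
  destruct q as [[]|], e; rewrite /= ?e7 /=;
    try (apply: run_branch; rewrite e7);
    solve [by apply: rej; rewrite andbF
          |by apply: skip; rewrite andbT
          |by apply: run_post (skip _) _ _ => //; rewrite andbT].
have h3 := run_pop 18 s2.
set s3 := upd s2 18 _ in h3.
have h4 : run (move1 7 17) s3 3 _ := @run_move1 7 17 s3 e r isT _.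
apply: run_post (run_seq h1 (run_seq h2 (run_seq h3 (h4 _)))) _ _.
- by rewrite /s3 /s2 /s1 /upd /=.
- lia.
- rewrite /s3 /s2 /s1; store_eq.
  + by rewrite ep rev_rcons.
  + by rewrite fr //; case: (q).
Qed.

Definition check_loop (c : cmd) : cmd := While 7 (check_step c).

(** Invariant: 17 holds the reversed prefix [p], 7 the rest [r], and the top of 0 the conjunction of
    the checks so far. The bounds mention only the sum of the sizes of [p] and [r], which a round
    preserves. *)
Lemma run_check_loop c N T s p r f ok o :
  free 18 s -> s 17 = rev p -> s 7 = r -> s 0 = ok :: o ->
  (forall p', size p' < size p + size r ->
    runs c [:: s 13; s 4; s 5; p'; s 6] T [:: seq_of_response (f p')]) ->
  size (s 13) + size (s 4) + size (s 5) + (size p + size r) + size (s 6) <= N ->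
  run (check_loop c) s (size r * (call_cost c (N + T) + 9)).+1
    (upd (upd (upd s 0 ((ok && consistent f p r) :: o)) 7 [::]) 17 (rev (p ++ r))).
Proof.
elim: r p ok s => [|e r IH] p ok s fr ep er eo hr hN /=.
  apply: run_post (run_while_end _ er) _ _ => //.
  by rewrite andbT cats0; store_eq.
have lt : size p < size p + size (e :: r) by rewrite /=; lia.
have leN : size (s 13) + size (s 4) + size (s 5) + size p + size (s 6) <= N.
  by move: hN => /=; lia.
have h1 := run_check_step fr ep er eo (hr p lt) leN.
set s1 := upd _ 17 _ in h1.
have fr1 : free 18 s1.
  by move=> q hq; rewrite /s1 /upd; do 3 (case: eqP => [?|_]; first lia); apply: fr.
have h2 := IH (rcons p e) (ok && agrees (f p) e) s1 fr1 erefl erefl erefl.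
rewrite size_rcons addSnnS in h2.
apply: run_post (run_while_step _ h1 (h2 hr hN)) _ _; first by rewrite er.
  lia.
by rewrite /s1; store_eq; rewrite -?andbA ?cat_rcons.
Qed.

Lemma free_le k k' s : k <= k' -> free k s -> free k' s.
Proof. by move=> le fr q leq; apply: fr; apply: leq_trans leq. Qed.

Definition check (c : cmd) : cmd := Seq (Push 0 true) (check_loop c).

Definition check_bob (c : cmd) : cmd := Seq (check c) (move 17 7).

Definition check_alice (c v : cmd) : cmd :=
  Seq (check c) (Seq (call v)
    (Seq (Branch 18 reject Skip Skip) (Seq (Pop 18) (move 17 7)))).

Lemma run_check c N T s f : free 16 s ->
  (forall p, size p < size (s 7) ->
    runs c [:: s 13; s 4; s 5; p; s 6] T [:: seq_of_response (f p)]) ->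
  size (s 13) + size (s 4) + size (s 5) + size (s 7) + size (s 6) <= N ->
  run (check c) s (size (s 7) * (call_cost c (N + T) + 9) + 2)
    (upd (upd (upd s 0 (consistent f [::] (s 7) :: s 0)) 7 [::]) 17 (rev (s 7))).
Proof.
move=> fr hc leN.
have h := @run_check_loop c N T (upd s 0 (true :: s 0)) [::] (s 7) f true (s 0).
apply: run_post (run_seq (run_push _ _ _) (h _ _ _ _ _ _)) _ _ => //.
- by move=> q hq; rewrite /upd; case: eqP => [?|_]; [lia|apply: fr; lia].
- by rewrite /upd /= fr.
- lia.
- by store_eq.
Qed.

Lemma emits_check_bob c N T s f : free 16 s ->
  (forall p, size p < size (s 7) ->
    runs c [:: s 13; s 4; s 5; p; s 6] T [:: seq_of_response (f p)]) ->
  size (s 13) + size (s 4) + size (s 5) + size (s 7) + size (s 6) <= N ->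
  emits (check_bob c) s ((size (s 7)).+1 * (call_cost c (N + T) + 13))
    [:: consistent f [::] (s 7)].
Proof.
move=> fr hc leN; have h := run_check fr hc leN.
apply: run_post (run_seq h (@run_move 17 7 _ _)) _ _ => //.
  by rewrite /upd /= size_rev; lia.
by store_eq; rewrite ?catrevE ?revK ?cats0 ?(fr 17).
Qed.

Lemma emits_check_alice c v N T s f w : free 16 s ->
  (forall p, size p < size (s 7) ->
    runs c [:: s 13; s 4; s 5; p; s 6] T [:: seq_of_response (f p)]) ->
  runs v [:: s 13; s 4; s 5; s 7; s 6] T [:: [:: w]] ->
  size (s 13) + size (s 4) + size (s 5) + size (s 7) + size (s 6) <= N ->
  emits (check_alice c v) s
    ((size (s 7)).+1 * (call_cost c (N + T) + call_cost v (N + T) + 20))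
    [:: consistent f [::] (s 7) && ~~ w].
Proof.
move=> fr hc hv leN; have h := run_check fr hc leN.
set s1 := upd _ 17 _ in h.
have fr1 : free 18 s1.
  by move=> q hq; rewrite /s1 /upd; do 3 (case: eqP => [?|_]; first lia); apply: fr; lia.
have h2 : run (call v) s1 (call_cost v (N + T)) (upd s1 18 [:: w]).
  exact: (@run_call v N T s1 (s 7) [:: w] fr1).
set s2 := upd s1 18 _ in h2.
pose s3 := upd s2 0 ((consistent f [::] (s 7) && ~~ w) :: s 0).
have h3 : run (Branch 18 reject Skip Skip) s2 3 s3.
  apply: run_branch; rewrite /s3; destruct w; rewrite /s2 {1}/upd /=.
    by rewrite andbF; apply: (@run_reject _ (consistent f [::] (s 7))).
  by apply: run_post (run_skip _) _ _ => //; rewrite andbT /s1; store_eq.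
apply: run_post (run_seq h (run_seq h2 (run_seq h3
  (run_seq (run_pop _ _) (@run_move 17 7 _ _))))) _ _ => //.
  by rewrite /s3 /s2 /s1 /upd /= size_rev; lia.
by rewrite /s3 /s2 /s1; store_eq; rewrite ?catrevE ?revK ?cats0 ?(fr 17) ?(fr 18).
Qed.

(** * Enumerating bit strings *)

(* Little-endian decrement with wrap-around; the flag signals the wrap. *)
Fixpoint dec (v : seq bool) : seq bool * bool :=
  match v with
  | [::] => ([::], true)
  | true :: v' => (false :: v', false)
  | false :: v' => (true :: (dec v').1, (dec v').2)
  end.

(** One digit of a schoolbook decrement. Register 19 is nonempty while a borrow is pending, and the
    digits already turned from 0 to 1 wait on 20. Running out of digits is the wrap-around, and
    popping [rn] then ends the enumeration. *)
Definition borrow (w rn : nat) : cmd :=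
  Branch w (Seq (Pop w) (Seq (Push w false) (Pop 19)))
           (Seq (Pop w) (Push 20 true))
           (Seq (Pop 19) (Pop rn)).

Definition decr (w rn : nat) : cmd :=
  Seq (Push 19 true) (Seq (While 19 (borrow w rn)) (move 20 w)).

(** How the digits are split between [w] and 20 depends on where the borrow stops; only the string
    obtained by moving 20 back onto [w] matters. *)
Lemma run_borrow (w rn : nat) v u s : w < 10 -> 10 <= rn < 16 ->
  s w = v -> s 19 = [:: true] -> s 20 = u ->
  exists u' v', [/\ catrev u' v' = catrev u (dec v).1, size u' <= size u + size v &
    run (While 19 (borrow w rn)) s (5 * size v + 8)
      (upd (upd (upd (upd s w v') 20 u') 19 [::]) rn
         (if (dec v).2 then behead (s rn) else s rn))].
Proof.
move=> hw hr; elim: v u s => [|[] v IH] u s ew e19 e20.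
- exists u, [::]; split=> //=; first by rewrite addn0.
  have h1 : run (borrow w rn) s 3 (upd (upd s 19 [::]) rn (behead (s rn))).
    apply: run_branch; rewrite ew.
    by apply: run_post (run_seq (run_pop _ _) (run_pop _ _)) _ _ => //; store_eq; rewrite e19.
  apply: run_post (run_while_step _ h1 (run_while_end _ _)) _ _ => //.
  + by rewrite e19.
  + by rewrite /upd; case: eqP => [?|_] //; lia.
  + by store_eq.
- exists u, (false :: v); split=> //=; first by lia.
  have h1 : run (borrow w rn) s 4 (upd (upd s 19 [::]) w (false :: v)).
    apply: run_branch; rewrite ew.
    apply: run_post (run_seq (run_pop _ _) (run_seq (run_push _ _ _) (run_pop _ _))) _ _ => //.
    by store_eq; rewrite ?ew ?e19.
  apply: run_post (run_while_step _ h1 (run_while_end _ _)) _ _ => //.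
  + by rewrite e19.
  + by rewrite /upd; case: eqP => [?|_] //; lia.
  + by lia.
  + by store_eq.
- have h1 : run (borrow w rn) s 3 (upd (upd s w v) 20 (true :: u)).
    apply: run_branch; rewrite ew.
    apply: run_post (run_seq (run_pop _ _) (run_push _ _ _)) _ _ => //.
    by store_eq; rewrite ?ew ?e20.
  set s1 := upd _ 20 _ in h1.
  have [|||u' [v' [eq le h2]]] := IH (true :: u) s1.
  + by rewrite /s1 /upd; case: eqP => [?|_]; [lia|rewrite eqxx].
  + by rewrite /s1 /upd /=; case: eqP => [?|_]; [lia|].
  + by [].
  exists u', v'; split=> //; first by move: le => /=; lia.
  apply: run_post (run_while_step _ h1 h2) _ _; first by rewrite e19.
    by rewrite /=; lia.
  by rewrite /s1; store_eq.
Qed.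

Lemma run_decr (w rn : nat) s : w < 10 -> 10 <= rn < 16 -> free 16 s ->
  run (decr w rn) s (9 * size (s w) + 10)
    (upd (upd s w (dec (s w)).1) rn
       (if (dec (s w)).2 then behead (s rn) else s rn)).
Proof.
move=> hw hr fr; set s1 := upd s 19 [:: true].
have h1 : run (Push 19 true) s 1 s1.
  by apply: run_post (run_push _ _ _) _ _; rewrite ?fr.
have ew : s1 w = s w by rewrite /s1 /upd; case: eqP => [?|_] //; lia.
have ern : s1 rn = s rn by rewrite /s1 /upd; case: eqP => [?|_] //; lia.
have [|u' [v' [eq le h2]]] := run_borrow hw hr ew erefl (_ : s1 20 = [::]).
  by rewrite /s1 /upd /= fr.
have ne : w != 20 by lia.
apply: run_post (run_seq h1 (run_seq h2 (run_move _ ne))) _ _.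
  have -> : upd (upd (upd (upd s1 w v') 20 u') 19 [::]) rn
    (if (dec (s w)).2 then behead (s1 rn) else s1 rn) 20 = u'.
    by rewrite /upd /=; case: eqP => [?|_] //; lia.
  by move: le => /=; lia.
have e19 : s 19 = [::] := fr 19 isT.
have e20 : s 20 = [::] := fr 20 isT.
have ewn : (w == rn) = false by lia.
by rewrite /s1; store_eq.
Qed.

(* Little-endian binary digits of [2 ^ m - 1 - i] (mod [2 ^ m]): the string
   reached from the all-ones string after [i] decrements. *)
Fixpoint code (m i : nat) : m.-tuple bool :=
  if m is m'.+1 then [tuple of ~~ odd i :: code m' i./2] else [tuple].

(** For even [i] the lowest digit is 1 and absorbs the borrow; for odd [i] the borrow passes to the
    digits of [i./2]. *)
Lemma dec_code m i : i < 2 ^ m ->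
  dec (code m i) = (val (code m i.+1), i.+1 == 2 ^ m).
Proof.
elim: m i => [|m IH] i /=; first by case: i.
rewrite expnS => lt; case: (boolP (odd i)) => oi /=.
  by rewrite uphalf_half oi IH /=; [congr pair; lia|lia].
by rewrite uphalf_half (negbTE oi); congr pair; lia.
Qed.

Lemma code_ones m i : i = 0 \/ i = 2 ^ m -> val (code m i) = nseq m true.
Proof.
elim: m i => [|m IH] i //= h; rewrite expnS in h.
by rewrite IH; [congr cons; lia|lia].
Qed.

(** Descending in [i], since later emissions land on top of earlier ones. *)
Definition strings (m : nat) : seq (m.-tuple bool) :=
  [seq code m i | i <- rev (iota 0 (2 ^ m))].

Lemma size_strings m : size (strings m) = 2 ^ m.
Proof. by rewrite size_map size_rev size_iota. Qed.

Lemma mem_strings m (v : m.-tuple bool) : v \in strings m.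
Proof.
suff [i lt <-] : exists2 i, i < 2 ^ m & code m i = v.
  by apply: map_f; rewrite mem_rev mem_iota.
elim: m v => [|m IH] v; first by exists 0 => //; rewrite [v]tuple0 [LHS]tuple0.
have [i lt e] := IH (behead_tuple v).
(* The lowest digit of [code] is the complement of the parity of the index. *)
exists (i.*2 + ~~ thead v); first by rewrite expnS; lia.
apply: val_inj => /=; rewrite [in RHS](tuple_eta v) /=.
rewrite -[behead v]/(val (behead_tuple v)) -e; congr (_ :: _).
  by rewrite oddD odd_double; case: (thead v).
by congr (val (code m _)); lia.
Qed.

Definition enum_cmd (w rn : nat) (body : cmd) : cmd :=
  Seq (Push rn true) (While rn (Seq body (decr w rn))).

Lemma emits_enum (w rn m T : nat) (body : cmd) (s : store)
    (g : m.-tuple bool -> seq bool) :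
  0 < w < 10 -> 10 <= rn < 16 -> free rn s -> s w = nseq m true ->
  (forall (v : m.-tuple bool) s', free rn.+1 s' -> s' w = v ->
     (forall q, 0 < q < rn -> q != w -> s' q = s q) -> emits body s' T (g v)) ->
  emits (enum_cmd w rn body) s (2 ^ m * (T + 9 * m + 11) + 2)
    (flatten [seq g v | v <- strings m]).
Proof.
move=> hw hr fr ew hb.
(* The store after [i] rounds. At [i = 2 ^ m] the code has wrapped to its initial value and the flag
   [rn] is gone. *)
pose S i := upd (upd (upd s w (code m i)) rn (if i < 2 ^ m then [:: true] else [::]))
  0 (flatten [seq g (code m j) | j <- rev (iota 0 i)] ++ s 0).
have code0 := code_ones (or_introl _ (erefl 0) : 0 = 0 \/ 0 = 2 ^ m).
have codeN := code_ones (or_intror _ (erefl (2 ^ m)) : 2 ^ m = 0 \/ 2 ^ m = 2 ^ m).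
have h1 : run (Push rn true) s 1 (S 0).
  apply: run_post (run_push _ _ _) _ _ => //.
  by rewrite /S expn_gt0; store_eq; rewrite ?(fr rn) ?code0 ?ew.
have S_rn i : S i rn = if i < 2 ^ m then [:: true] else [::].
  by rewrite /S /upd; repeat (case: eqP => ?; try lia).
have S_w i : S i w = code m i.
  by rewrite /S /upd; repeat (case: eqP => ?; try lia).
have frS i : free rn.+1 (S i).
  by move=> q hq; rewrite /S /upd; repeat (case: eqP => ?; try lia); apply: fr; lia.
have h2 i : i < 2 ^ m ->
    S i rn <> [::] /\ run (Seq body (decr w rn)) (S i) (T + 9 * m + 10) (S i.+1).
  move=> lt; rewrite S_rn lt; split=> //.
  have hb' : emits body (S i) T (g (code m i)).
    apply: hb => // q hq /eqP ne; rewrite /S /upd.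
    by repeat (case: eqP => ?; try lia).
  rewrite /emits in hb'; set s1 := upd (S i) 0 _ in hb'.
  have s1w : s1 w = code m i.
    by rewrite /s1 {1}/upd; case: eqP => [?|_]; [lia|rewrite S_w].
  have fr1 : free 16 s1.
    move=> q hq; rewrite /s1 /upd; case: eqP => [?|_]; first by lia.
    by apply: frS; lia.
  have hd := @run_decr w rn s1 _ hr fr1.
  rewrite s1w size_tuple dec_code //= in hd.
  apply: run_post (run_seq hb' (hd _)) _ _; [lia|lia|].
  have er : rev (iota 0 i.+1) = i :: rev (iota 0 i).
    by rewrite -addn1 iotaD rev_cat.
  rewrite /s1 /S er /=; store_eq.
  + by rewrite lt; case: ifP => //; lia.
  + by rewrite lt; case: ifP => //; lia.
  + by rewrite catA.
apply: run_post (run_seq h1 (run_while h2 _)) _ _.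
- by rewrite S_rn ltnn.
- by lia.
- rewrite /S ltnn; store_eq; rewrite ?(fr rn) //.
  + by rewrite /strings -map_comp.
  + by rewrite ew codeN.
Qed.

(** * The loop over the input vectors *)

Definition get_vec : cmd :=
  Seq (While 3 (Seq (Pop 3) (Seq (Push 16 true) (move1 8 20))))
      (Seq (move 16 3) (move 20 13)).

Lemma run_get_vec s z x : s 3 = nseq (size z) true -> s 8 = z ++ x -> free 13 s ->
  run get_vec s (14 * size z + 3) (upd (upd s 13 z) 8 x).
Proof.
move=> e3 e8 fr.
have loop : run (While 3 (Seq (Pop 3) (Seq (Push 16 true) (move1 8 20)))) s
    (6 * size z).+1
    (upd (upd (upd (upd s 3 [::]) 8 x) 16 (catrev (nseq (size z) true) (s 16)))
       20 (catrev z (s 20))).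
  elim: z s e3 e8 {fr} => [|b z IH] s /= e3 e8.
    by apply: run_post (run_while_end _ e3) _ _ => //; store_eq.
  have hp := run_pop 3 s; rewrite e3 /= in hp.
  set s0 := upd s 3 _ in hp.
  have h2 := @run_move1 8 20 (upd s0 16 (true :: s 16)) b (z ++ x) isT e8.
  set s2 := upd _ 20 _ in h2.
  have h3 : run (Seq (Pop 3) (Seq (Push 16 true) (move1 8 20))) s 5 s2.
    exact: run_seq hp (run_seq (run_push _ _ _) h2).
  apply: run_post (run_while_step _ h3 (IH s2 erefl erefl)) _ _; first by rewrite e3.
    by lia.
  by rewrite /s2 /s0; store_eq.
have [e16 e20 e13] : [/\ s 16 = [::], s 20 = [::] & s 13 = [::]] by rewrite !fr.
apply: run_post (run_seq loop (run_seq (@run_move 16 3 _ isT) (@run_move 20 13 _ isT))) _ _.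
  by rewrite /upd /= e16 e20 -!/(rev _) !size_rev size_nseq; lia.
store_eq; rewrite ?e16 ?e20 ?e13 //.
  by rewrite -!/(rev _) revK.
by rewrite -!/(rev _) revK e3.
Qed.

Definition vec_step (body : cmd) : cmd :=
  Seq (Pop 2) (Seq (Push 11 true) (Seq get_vec (Seq body (move 13 12)))).

(** The vectors read pile up on 12 as one reversed string, so a single move rebuilds the input on 8;
    another one rebuilds the counter [n] from 11. *)
Definition vec_loop (body : cmd) : cmd :=
  Seq (While 2 (vec_step body)) (Seq (move 11 2) (move 12 8)).

Lemma bits_cons d (z : d.-tuple bool) A : bits (z :: A) = z ++ bits A.
Proof. by []. Qed.

Lemma size_bits d (A : seq (d.-tuple bool)) : size (bits A) = size A * d.
Proof. by elim: A => //= z A IH; rewrite bits_cons size_cat size_tuple IH mulSn. Qed.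

Lemma emits_vec_loop d T body s (A : seq (d.-tuple bool))
    (g : d.-tuple bool -> seq bool) :
  s 2 = nseq (size A) true -> s 3 = nseq d true -> s 8 = bits A -> free 11 s ->
  (forall (z : d.-tuple bool) s', free 14 s' -> s' 13 = z ->
     (forall q, 2 < q < 8 -> s' q = s q) -> emits body s' T (g z)) ->
  emits (vec_loop body) s (size A * (T + 22 * d + 12) + 3)
    (flatten [seq g z | z <- rev A]).
Proof.
move=> e2 e3 e8 fr hb.
have loop : run (While 2 (vec_step body)) s (size A * (T + 18 * d + 8)).+1
    (upd (upd (upd (upd (upd s 2 [::]) 8 [::])
       11 (catrev (nseq (size A) true) (s 11))) 12 (catrev (bits A) (s 12)))
       0 (flatten [seq g z | z <- rev A] ++ s 0)).
  (* Registers 11 and 12 fill up during the loop, so the induction may assume emptiness only from 13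
     on. *)
  have {}fr : free 13 s by apply: free_le fr.
  elim: A s e2 e3 e8 fr hb => [|z A IH] s e2 e3 e8 fr hb.
    by apply: run_post (run_while_end _ e2) _ _ => //; store_eq.
  rewrite bits_cons in e8 *.
  set s1 := upd (upd s 2 (nseq (size A) true)) 11 (true :: s 11).
  set s2 := upd (upd s1 13 z) 8 (bits A).
  set s3 := upd s2 0 (g z ++ s 0).
  set s4 := upd (upd s3 13 [::]) 12 (catrev z (s 12)).
  have h12 : run get_vec s1 (14 * d + 3) s2.
    rewrite -{1}(size_tuple z); apply: run_get_vec => //.
      by rewrite size_tuple.
    move=> q hq; rewrite /s1 /upd.
    by do 2 (case: eqP => [?|_]; first lia); apply: fr.
  have h23 : run body s2 T s3.
    apply: hb => //.
      move=> q hq; rewrite /s2 /s1 /upd.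
      by do 4 (case: eqP => [?|_]; first lia); apply: fr; lia.
    move=> q hq; rewrite /s2 /s1 /upd.
    by do 4 (case: eqP => [?|_]; first lia).
  have h34 : run (move 13 12) s3 (4 * d + 1) s4.
    by apply: run_post (@run_move 13 12 _ isT) _ _ => //;
      rewrite /s3 /s2 /upd /= size_tuple; lia.
  have hp := run_pop 2 s; rewrite e2 /= in hp.
  have h : run (vec_step body) s (T + 18 * d + 6) s4.
    by apply: run_post (run_seq hp (run_seq (run_push _ _ _)
      (run_seq h12 (run_seq h23 h34)))) _ _ => //; lia.
  have fr4 : free 13 s4.
    move=> q hq; rewrite /s4 /s3 /s2 /s1 /upd.
    by do 6 (case: eqP => [?|_]; first by [|lia]); apply: fr; lia.
  have h4 := IH s4 erefl e3 erefl fr4.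
  apply: run_post (run_while_step _ h (h4 _)) _ _; first by rewrite e2.
  - move=> v s' fr' e' same; apply: hb => // q hq; rewrite same //.
    rewrite /s4 /s3 /s2 /s1 /upd.
    by do 6 (case: eqP => [?|_]; first lia).
  - by rewrite /=; lia.
  - rewrite /s4 /s3 /s2 /s1; store_eq.
    + by rewrite rev_cons map_rcons flatten_rcons catA.
    + by rewrite catrevE catrevE catrevE rev_cat catA.
    + by rewrite fr.
have [e11 e12] : s 11 = [::] /\ s 12 = [::] by rewrite !fr.
apply: run_post (run_seq loop (run_seq (@run_move 11 2 _ isT) (@run_move 12 8 _ isT))) _ _.
  by rewrite /upd /= e11 e12 -!/(rev _) !size_rev size_nseq size_bits; lia.
by store_eq; rewrite ?e11 ?e12 -?/(rev _) ?revK ?e2 ?e8.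
Qed.

(** * The nested loops for one side *)

Definition coords (m2 l : nat) : seq (m2.-tuple bool * l.-tuple bool) :=
  [seq (b, t) | b <- strings m2, t <- strings l].

Definition side (chk : cmd) : cmd :=
  enum_cmd 4 10 (vec_loop (enum_cmd 5 14 (enum_cmd 7 15 chk))).

(** An enumeration keeps a cost of the form constant times volume: since [m < Y], its overhead adds
    only 11 + 2 to the constant. *)
Lemma enum_bound p C Y m : 0 < p -> m < Y ->
  p * (C * Y + 9 * m + 11) + 2 <= (C + 13) * (p * Y).
Proof.
move=> p0 lt.
have : p * (9 * m + 11) <= p * (11 * Y) by rewrite leq_mul2l; lia.
have : 0 < p * Y by rewrite muln_gt0; lia.
nia.
Qed.

(** Here the overhead adds 22 + 3. The factor [maxn 1 n] pays for the loop's fixed cost when [n] is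
    0. *)
Lemma vec_loop_bound n C Y m : m < Y ->
  n * (C * Y + 22 * m + 12) + 3 <= (C + 25) * (maxn 1 n * Y).
Proof.
move=> lt; set N := maxn 1 n.
have : n * (C * Y + 22 * m + 12) <= N * ((C + 22) * Y) by apply: leq_mul; lia.
have : 0 < N * Y by rewrite muln_gt0; lia.
nia.
Qed.

Lemma emits_side d m1 m2 l T chk s (A : seq (d.-tuple bool))
    (f : d.-tuple bool -> m1.-tuple bool -> m2.-tuple bool * l.-tuple bool -> bool) :
  s 2 = nseq (size A) true -> s 3 = nseq d true -> s 4 = nseq m1 true ->
  s 5 = nseq m2 true -> s 6 = nseq l true -> s 7 = nseq l true ->
  s 8 = bits A -> free 10 s ->
  (forall z a p s', free 16 s' -> s' 13 = val z -> s' 4 = val a ->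
    s' 5 = val p.1 -> s' 7 = val p.2 -> s' 6 = nseq l true ->
    emits chk s' T [:: f z a p]) ->
  d + m1 + m2 + l < T ->
  emits (side chk) s (65 * (2 ^ (m1 + (m2 + l)) * maxn 1 (size A) * T))
    (flatten [seq flatten [seq map (f z a) (coords m2 l) | z <- rev A] | a <- strings m1]).
Proof.
move=> e2 e3 e4 e5 e6 e7 e8 fr hchk ltT.
(* From the inside out, over t, b, the vectors and a, the constant grows as 1, 14, 27, 52, 65. *)
set Y1 := 2 ^ l * T; set Y2 := 2 ^ m2 * Y1; set Y3 := maxn 1 (size A) * Y2.
have leY1 : T <= Y1 by rewrite leq_pmull // expn_gt0.
have leY2 : Y1 <= Y2 by rewrite leq_pmull // expn_gt0.
have leY3 : Y2 <= Y3 by rewrite leq_pmull //; lia.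
apply: run_post (@emits_enum 4 10 m1 (52 * Y3) _ _ _ isT isT fr e4 _) _ _.
2: { apply: leq_trans (enum_bound _ _ _) _; [by rewrite expn_gt0|by lia|].
     by rewrite !expnD /Y3 /Y2 /Y1; lia. }
2: { by []. }
move=> a s1 fr1 e1a same1.
have le3 : size A * (27 * Y2 + 22 * d + 12) + 3 <= 52 * Y3.
  by apply: vec_loop_bound; lia.
apply: run_post (@emits_vec_loop d (27 * Y2) _ _ A
  (fun z => map (f z a) (coords m2 l)) _ _ _ _ _) le3 _ => //;
  try by rewrite same1.
move=> z s2 fr2 e2z same2.
have e45 : s2 5 = nseq m2 true by rewrite same2 // same1.
apply: run_post (@emits_enum 5 14 m2 (14 * Y1) _ _
  (fun b => [seq f z a (b, t) | t <- strings l]) isT isT fr2 e45 _) _ _.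
2: { by apply: enum_bound; rewrite ?expn_gt0 //; lia. }
2: { by rewrite /coords map_allpairs. }
move=> b s3 fr3 e3b same3.
have e37 : s3 7 = nseq l true by rewrite same3 // same2 // same1.
apply: run_post (@emits_enum 7 15 l T _ _
  (fun t => [:: f z a (b, t)]) isT isT fr3 e37 _) _ _.
2: { by rewrite -{1}[T]mul1n; apply: enum_bound; rewrite ?expn_gt0 //; lia. }
2: { by rewrite flatten_map1. }
move=> t s4 fr4 e4t same4.
apply: hchk => //=; rewrite same4 //.
- by rewrite same3.
- by rewrite same3 // same2.
- by rewrite same3 // same2 // same1.
Qed.

(** * Correctness of the instances *)

Section Correctness.
Variables (d m1 m2 l : nat) (P : protocol d m1 m2 l).

Definition alice_bit (x : d.-tuple bool) (a : m1.-tuple bool)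
    (p : m2.-tuple bool * l.-tuple bool) : bool :=
  consistent (alice P x a p.1) [::] p.2 && ~~ verdict P x a p.1 p.2.

Definition bob_bit (y : d.-tuple bool) (a : m1.-tuple bool)
    (p : m2.-tuple bool * l.-tuple bool) : bool :=
  consistent (bob P y a p.1) [::] p.2.

Lemma size_coords : size (coords m2 l) == 2 ^ (m2 + l).
Proof. by rewrite size_allpairs !size_strings expnD. Qed.

Definition vec (f : m2.-tuple bool * l.-tuple bool -> bool) :
    (2 ^ (m2 + l)).-tuple bool :=
  map_tuple f (Tuple size_coords).

(** A sum of naturals vanishes iff all its terms do, so it only matters that [coords] contains every
    pair, not in which order. *)
Lemma inner_vec f g :
  (inner (vec f) (vec g) == 0) = [forall p, ~~ (f p && g p)].
Proof.
rewrite /inner sum_nat_eq0; apply/forallP/forallP => h.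
  move=> p; have : p \in Tuple size_coords.
    by case: p => b t; apply: allpairs_f; apply: mem_strings.
  case/tnthP=> i ->; have := h i; rewrite !tnth_map.
  by case: (f _); case: (g _).
move=> i; rewrite !tnth_map; have := h (tnth (Tuple size_coords) i).
by case: (f _); case: (g _).
Qed.

Section Run.
Variables (x y : d.-tuple bool) (a : m1.-tuple bool) (b : m2.-tuple bool).
Local Notation tr := (transcript P x y a b).

Lemma transcript_step k : size (tr k) < l ->
  exists2 c, tr k.+1 = rcons (tr k) c &
    forall e, agrees (alice P x a b (tr k)) e && agrees (bob P y a b (tr k)) e = (c == e).
Proof.
move=> /(one_speaker P x y a b) /=.
case: (alice _ _ _ _ _) => [c|]; case: (bob _ _ _ _ _) => [c'|] //= _.
  by exists c => // e; rewrite andbT.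
by exists c'.
Qed.

Lemma size_transcript k : k <= l -> size (tr k) = k.
Proof.
elim: k => // k IH lt.
have e := IH (ltnW lt).
by have [|c -> _] := @transcript_step k; rewrite ?size_rcons e.
Qed.

(** Starting after [k] real steps permits induction on [r]: its next bit is compared with the bit
    [c] actually sent. *)
Lemma prefix_transcript k r L : k + size r = L -> L <= l ->
  consistent (alice P x a b) (tr k) r && consistent (bob P y a b) (tr k) r
    = (tr L == tr k ++ r).
Proof.
elim: r k => [|e r IH] k /= h leL; first by rewrite cats0 -h addn0 eqxx.
have lt : size (tr k) < l by rewrite size_transcript; lia.
have [c [eT hc]] := transcript_step lt.
rewrite andbACA hc; case: eqP => [<-|ne] /=.
  by rewrite -eT IH ?eT ?cat_rcons //; lia.
apply/esym/eqP => e1; apply: ne.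
(* After a mismatch it suffices that transcripts only grow: [tr L] still has [c] at position [k],
   where [r] proposes [e]. *)
have [r' e2] : exists r', tr L = tr k.+1 ++ r'.
  have : k.+1 <= L by lia.
  elim: (L) => [|j IHj]; first by lia.
  rewrite leq_eqVlt => /orP [/eqP <-|]; first by exists [::]; rewrite cats0.
  move=> /IHj [r'' e3] /=; rewrite e3.
  case: (alice _ _ _ _ _) => [u|]; last case: (bob _ _ _ _ _) => [u|];
    by [exists (rcons r'' u); rewrite rcons_cat|exists r''].
move: e1; rewrite e2 eT cat_rcons => /eqP.
by rewrite eqseq_cat // eqxx /= eqseq_cons => /andP [/eqP].
Qed.

Lemma bits_accepts :
  [forall t : l.-tuple bool, ~~ (alice_bit x a (b, t) && bob_bit y a (b, t))]
    = accepts P x y a b.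
Proof.
have st : size (tr l) == l by rewrite size_transcript.
have e (t : l.-tuple bool) :
    alice_bit x a (b, t) && bob_bit y a (b, t) = (tr l == t) && ~~ verdict P x a b t.
  have := @prefix_transcript 0 t l; rewrite size_tuple => /(_ erefl (leqnn l)) /= <-.
  by rewrite /alice_bit /bob_bit /=; case: (consistent _ _ _) => //; rewrite andbC.
rewrite /accepts; apply/forallP/idP => [h|h t].
  by have := h (Tuple st); rewrite e /= eqxx negbK.
by rewrite e; case: eqP => //= <-; rewrite negbK.
Qed.

End Run.

Lemma vec_accepts x y a :
  (inner (vec (alice_bit x a)) (vec (bob_bit y a)) == 0) =
    [forall b, accepts P x y a b].
Proof.
rewrite inner_vec; apply/forallP/forallP => [h b|h [b t]].
  by rewrite -bits_accepts; apply/forallP => t; apply: h.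
by have := h b; rewrite -bits_accepts => /forallP.
Qed.

(* Vectors come out in reverse order because emitted bits are pushed on a stack. *)
Definition inst n (I : instance n d) (a : m1.-tuple bool) :
    instance n (2 ^ (m2 + l)) :=
  (map_tuple (fun x => vec (alice_bit x a)) (rev_tuple I.1),
   map_tuple (fun y => vec (bob_bit y a)) (rev_tuple I.2)).

Lemma OV_inst n (I : instance n d) a : OV (inst I a) <->
  exists x y, [/\ x \in I.1, y \in I.2 & forall b, accepts P x y a b].
Proof.
split.
  move=> [_ [_ [/mapP [x hx ->] /mapP [y hy ->]]]] /=.
  rewrite vec_accepts => /forallP h; exists x, y.
  by rewrite -[x \in _]mem_rev -[y \in _]mem_rev.
move=> [x [y [hx hy h]]]; exists (vec (alice_bit x a)), (vec (bob_bit y a)).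
split; [apply: map_f|apply: map_f|]; rewrite ?mem_rev //.
by rewrite vec_accepts; apply/forallP.
Qed.

Definition insts n (I : instance n d) : (2 ^ m1).-tuple (instance n (2 ^ (m2 + l))) :=
  map_tuple (inst I) (Tuple (introT eqP (size_strings m1))).

Lemma insts_correct F n (I : instance n d) : sigma2_computes P F ->
  satisfying_pair F I <-> exists j, OV (tnth (insts I) j).
Proof.
move=> hF; split.
  move=> [x [y [hx hy /hF [a ha]]]].
  have /tnthP [j ej] : a \in Tuple (introT eqP (size_strings m1)) by apply: mem_strings.
  by exists j; rewrite tnth_map -ej; apply/OV_inst; exists x, y.
move=> [j]; rewrite tnth_map => /OV_inst [x [y [hx hy h]]].
by exists x, y; split => //; apply/hF; exists (tnth (Tuple (introT eqP (size_strings m1))) j).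
Qed.

End Correctness.

(** * Running the reduction *)

Lemma run_size c s T s' r : run c s T s' -> size (s' r) <= size (s r) + T.
Proof.
move=> [t [s1 [le ex <-]]].
by apply: leq_trans (exec_size r ex) _; rewrite leq_add2l.
Qed.

Lemma runs_le c inp out T T' : T <= T' -> runs c inp T out -> runs c inp T' out.
Proof. by move=> le [t [s [le' ex h]]]; exists t, s; split => //; apply: leq_trans le. Qed.

Definition transfer (r q : nat) : cmd := Seq (move r 20) (move 20 q).

Lemma run_transfer r q s : s 20 = [::] -> s q = [::] -> r < 20 -> q < 20 -> r != q ->
  run (transfer r q) s (8 * size (s r) + 2) (upd (upd s r [::]) q (s r)).
Proof.
move=> e20 eq r20 q20 rq; have [n1 n2] : 20 != r /\ q != 20 by lia.
apply: run_post (run_seq (run_move s n1) (run_move _ n2)) _ _.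
  by rewrite {1}/upd /= e20 -/(rev _) size_rev; lia.
by store_eq; rewrite ?e20 ?eq -?/(rev _) ?revK.
Qed.

(** Register 6 is copied to 7 because [l] serves both as an argument of the response programs and as
    the first candidate transcript. The red output waits reversed on 9, and the final move restores
    its order. *)
Definition reduction (cA cB cV : cmd) : cmd :=
  Seq (copy 6 7 20) (Seq (transfer 0 8) (Seq (side (check_alice cA cV))
  (Seq (clear 8) (Seq (transfer 1 8) (Seq (move 0 9) (Seq (side (check_bob cB))
  (Seq (transfer 0 1) (move 9 0)))))))).

(** The summand [U] makes the cost exceed all lengths over which the loops run, as [emits_side]
    requires. *)
Definition check_cost (cA cB cV : cmd) (k U l : nat) : nat :=
  let M := U + k * U ^ k in
  l.+1 * (call_cost cA M + call_cost cB M + call_cost cV M + 20) + U.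

Section Reduction.
Variables (d m1 m2 l : nat) (P : protocol d m1 m2 l) (cA cB cV : cmd) (k : nat).
Hypothesis eff : forall (z : d.-tuple bool) (a : m1.-tuple bool)
    (b : m2.-tuple bool) (t : seq bool),
  let inp := [:: val z; val a; val b; t; unary l] in
  (size t < l ->
     runs_poly cA k inp [:: seq_of_response (alice P z a b t)] /\
     runs_poly cB k inp [:: seq_of_response (bob P z a b t)]) /\
  (size t = l -> runs_poly cV k inp [:: [:: verdict P z a b t]]).

(** [l] counts twice: once for the transcript and once for the unary length given to the parties. *)
Let U := (d + m1 + m2 + l + l).+1.
Let T := check_cost cA cB cV k U l.

Lemma runs_poly_le c z (a : m1.-tuple bool) (b : m2.-tuple bool) t out :
  size t <= l ->
  runs_poly c k [:: val (z : d.-tuple bool); val a; val b; t; unary l] out ->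
  runs c [:: val z; val a; val b; t; unary l] (k * U ^ k) out.
Proof.
move=> le; apply: runs_le; rewrite leq_mul2l; apply/orP; right.
case: k => // k'; rewrite leq_exp2r // /= !size_tuple /U; lia.
Qed.

Section Chk.
Variables (z : d.-tuple bool) (a : m1.-tuple bool)
  (p : m2.-tuple bool * l.-tuple bool) (s : store).
Hypotheses (fr : free 16 s) (e13 : s 13 = val z) (e4 : s 4 = val a)
  (e5 : s 5 = val p.1) (e7 : s 7 = val p.2) (e6 : s 6 = nseq l true).

Lemma chk_size : size (s 13) + size (s 4) + size (s 5) + size (s 7) + size (s 6) <= U.
Proof. by rewrite e13 e4 e5 e6 e7 !size_tuple /U; lia. Qed.

Lemma emits_alice : emits (check_alice cA cV) s T [:: alice_bit P z a p].
Proof.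
have h := @emits_check_alice cA cV U (k * U ^ k) s (alice P z a p.1)
  (verdict P z a p.1 p.2) fr _ _ chk_size.
rewrite e13 e4 e5 e6 e7 size_tuple in h.
apply: run_post (h _ _) _ _ => //.
- by move=> q lt; apply: runs_poly_le; [exact: ltnW|exact: (proj1 ((eff z a p.1 q).1 lt))].
- by apply: runs_poly_le; [rewrite size_tuple|apply: (eff z a p.1 p.2).2; rewrite size_tuple].
- by rewrite /T /check_cost; nia.
Qed.

Lemma emits_bob : emits (check_bob cB) s T [:: bob_bit P z a p].
Proof.
have h := @emits_check_bob cB U (k * U ^ k) s (bob P z a p.1) fr _ chk_size.
rewrite e13 e4 e5 e6 e7 size_tuple in h.
apply: run_post (h _) _ _ => //.
- by move=> q lt; apply: runs_poly_le; [exact: ltnW|exact: (proj2 ((eff z a p.1 q).1 lt))].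
- by rewrite /T /check_cost; nia.
Qed.
End Chk.

(** The two sides cost [65 * W] each. Moving their outputs takes [520 * W] for red, in two moves,
    and [520 * W] for blue, in one order-preserving transfer. What 1300 leaves over covers the
    handling of the inputs. *)
Lemma runs_reduction n (I : instance n d) :
  runs (reduction cA cB cV) (reduction_input m1 m2 l I)
    (1300 * (2 ^ (m1 + (m2 + l)) * maxn 1 n * T)) (reduction_output (insts P I)).
Proof.
set W := 2 ^ (m1 + (m2 + l)) * maxn 1 n * T.
have ltT : d + m1 + m2 + l < T by rewrite /T /check_cost /U; lia.
have leTW : maxn 1 n * T <= W by rewrite /W -mulnA leq_pmull // expn_gt0.
have leT : T <= W by apply: leq_trans leTW; rewrite leq_pmull //; lia.
have leA : n * d <= W by apply: leq_trans leTW; apply: leq_mul; lia.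
pose out (f : _ -> _ -> _ -> bool) (A : n.-tuple (d.-tuple bool)) :=
  flatten [seq flatten [seq map (f z a) (coords m2 l) | z <- rev A] | a <- strings m1].
have -> : reduction_output (insts P I) =
    [:: out (alice_bit P) I.1; out (bob_bit P) I.2].
  have outE f A : out f A = flatten
      [seq bits [seq vec (f x a) | x <- rev A] | a <- strings m1].
    by congr flatten; apply: eq_map => a; rewrite /bits -map_comp.
  by rewrite /reduction_output /= -2!(map_comp _ (inst P I)) !outE.
set s0 : store := nth [::] (reduction_input m1 m2 l I).
have fr0 : free 7 s0 by move=> q hq; rewrite /s0 nth_default.
pose s1 := upd s0 7 (unary l).
have h1 : run (copy 6 7 20) s0 (9 * l + 2) s1.
  apply: run_post (@run_copy 6 7 20 _ isT isT isT _) _ _ => //.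
    by rewrite /s0 /= /unary size_nseq.
  by apply: upd_ext => //; rewrite /s0 /= cats0.
set OA := out (alice_bit P) _; set OB := out (bob_bit P) _.
pose s2 := upd (upd s1 0 [::]) 8 (bits I.1).
have h2 : run (transfer 0 8) s1 (8 * (n * d) + 2) s2.
  apply: run_post (@run_transfer 0 8 s1 _ _ isT isT isT) _ _ => //.
  by rewrite /s1 /upd /s0 /= size_bits size_tuple.
have h3 : emits (side (check_alice cA cV)) s2 (65 * W) OA.
  have := @emits_side d m1 m2 l T (check_alice cA cV) s2 I.1 (alice_bit P).
  rewrite size_tuple; apply => //; last exact: emits_alice.
  by move=> q hq; rewrite /s2 /s1 /upd; do 3 (case: eqP => [?|_]; first lia); apply: fr0; lia.
(* The output length is bounded by the running time instead of being counted. *)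
have szA := run_size 0 h3; rewrite /= in szA.
have {}szA : size OA <= 65 * W by move: szA; rewrite {1}/upd /= cats0.
pose s3 := upd s2 0 OA.
have {}h3 : run (side (check_alice cA cV)) s2 (65 * W) s3.
  by apply: run_post h3 _ _ => //; rewrite cats0.
pose s4 := upd s3 8 [::].
have h4 : run (clear 8) s3 (2 * (n * d) + 1) s4.
  by apply: run_post (run_clear _ _) _ _ => //;
      rewrite /s3 /s2 /upd /= size_bits size_tuple; lia.
pose s5 := upd (upd s4 1 [::]) 8 (bits I.2).
have h5 : run (transfer 1 8) s4 (8 * (n * d) + 2) s5.
  apply: run_post (@run_transfer 1 8 s4 _ _ isT isT isT) _ _ => //.
  by rewrite /s4 /s3 /s2 /s1 /upd /s0 /= size_bits size_tuple.
pose s6 := upd (upd s5 0 [::]) 9 (rev OA).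
have h6 : run (move 0 9) s5 (4 * (65 * W) + 1) s6.
  by apply: run_post (@run_move 0 9 s5 isT) _ _ => //; rewrite /s5 /s4 /s3 /upd /=; lia.
have h7 : emits (side (check_bob cB)) s6 (65 * W) OB.
  have := @emits_side d m1 m2 l T (check_bob cB) s6 I.2 (bob_bit P).
  rewrite size_tuple; apply => //; last exact: emits_bob.
  move=> q hq; rewrite /s6 /s5 /s4 /s3 /s2 /s1 /upd.
  by repeat (case: eqP => [?|_]; first lia); apply: fr0; lia.
have szB := run_size 0 h7; rewrite /= in szB.
have {}szB : size OB <= 65 * W by move: szB; rewrite {1}/upd /= cats0.
pose s7 := upd s6 0 OB.
have {}h7 : run (side (check_bob cB)) s6 (65 * W) s7.
  by apply: run_post h7 _ _ => //; rewrite cats0.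
pose s8 := upd (upd s7 0 [::]) 1 OB.
have h8 : run (transfer 0 1) s7 (8 * (65 * W) + 2) s8.
  by apply: run_post (@run_transfer 0 1 s7 _ _ isT isT isT) _ _ => //;
      rewrite /s7 /upd /=; lia.
pose s9 := upd (upd s8 9 [::]) 0 OA.
have h9 : run (move 9 0) s8 (4 * (65 * W) + 1) s9.
  apply: run_post (@run_move 9 0 s8 isT) _ _ => //.
    by rewrite /s8 /s7 /s6 /upd /= size_rev; lia.
  by apply: upd_ext => //; rewrite /s8 /s7 /s6 /upd /= -/(rev _) revK.
have [t [s [le ex E]]] := run_seq h1 (run_seq h2 (run_seq h3 (run_seq h4 (run_seq h5
  (run_seq h6 (run_seq h7 (run_seq h8 h9))))))).
exists t, s; split=> //; first by lia.
by move=> r lt; rewrite E; case: r lt => [|[|]].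
Qed.
End Reduction.

(** The polynomial in the total length [U] splits because [U <= d.+1 * 2 ^ (2 * E)]: the message
    lengths are absorbed by the exponential and only [d] stays polynomial. One [c] serves as factor
    and in both exponents. *)
Lemma cost_bound (cA cB cV : cmd) (k : nat) : exists c, forall d m1 m2 l n,
  1300 * (2 ^ (m1 + (m2 + l)) * maxn 1 n *
    check_cost cA cB cV k (d + m1 + m2 + l + l).+1 l)
  <= c * (maxn 1 n * 2 ^ (c * (m1 + m2 + l)) * d.+1 ^ c).
Proof.
(* Three call costs contribute 3 * 60, and the additive 20 completes the 200. *)
pose Q := 200 + 2 * (maxn 5 (regs cA) + maxn 5 (regs cB) + maxn 5 (regs cV)).
pose C := Q * (k + 2) + 1.
(* The second summand covers the exponent of 2: one [E] from the loops and [2 * E * (k + 2)] from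
   the power of [U]. *)
exists (1300 * C + (2 * (k + 2)).+1) => d m1 m2 l n.
set c := 1300 * C + _; set U := (d + _ + _ + _ + _).+1; set E := m1 + m2 + l.
have hT : check_cost cA cB cV k U l <= C * U ^ (k + 2).
  have p1 : U ^ k.+1 <= U ^ (k + 2) by rewrite leq_pexp2l //; lia.
  have p2 : U <= U ^ k.+1 by rewrite -{1}[U]expn1 leq_pexp2l.
  have p3 : U ^ k <= U ^ k.+1 by rewrite leq_pexp2l.
  have hM : (U + k * U ^ k).+1 <= (k + 2) * U ^ k.+1.
    have : k * U ^ k <= k * U ^ k.+1 by rewrite leq_mul2l p3 orbT.
    have : 0 < U ^ k by rewrite expn_gt0.
    move: p2; rewrite expnS; nia.
  have hQ : call_cost cA (U + k * U ^ k) + call_cost cB (U + k * U ^ k) +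
      call_cost cV (U + k * U ^ k) + 20 <= Q * (U + k * U ^ k).+1.
    by rewrite /call_cost /Q; nia.
  have hl : l.+1 <= U by rewrite /U; lia.
  have h : l.+1 * (call_cost cA (U + k * U ^ k) + call_cost cB (U + k * U ^ k) +
      call_cost cV (U + k * U ^ k) + 20) <= U * (Q * ((k + 2) * U ^ k.+1)).
    by apply: leq_mul => //; apply: leq_trans hQ _; rewrite leq_mul2l hM orbT.
  have e : U ^ (k + 2) = U * U ^ k.+1 by rewrite -expnS addnC.
  rewrite /check_cost /C; apply: leq_trans (leq_add h (leq_trans p2 p1)) _.
  by rewrite e; nia.
have hU : U <= d.+1 * 2 ^ (2 * E).
  have h : (2 * E).+1 <= 2 ^ (2 * E) by apply: ltn_expl.
  apply: leq_trans (leq_mul (leqnn d.+1) h); rewrite /U /E; nia.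
have hUk : U ^ (k + 2) <= d.+1 ^ (k + 2) * 2 ^ (2 * E * (k + 2)).
  by rewrite expnM -expnMn leq_exp2r //; lia.
have h1 : d.+1 ^ (k + 2) <= d.+1 ^ c by rewrite leq_pexp2l // /c; lia.
have h2 : 2 ^ E * 2 ^ (2 * E * (k + 2)) <= 2 ^ (c * E).
  by rewrite -expnD leq_pexp2l // /c; nia.
have h3 : 1300 * C <= c by rewrite /c; lia.
have -> : m1 + (m2 + l) = E by rewrite /E addnA.
apply: leq_trans (leq_mul h3 (leq_mul (leq_mul (leqnn (maxn 1 n)) h2) h1)).
have := leq_trans hT (leq_mul (leqnn C) hUk).
set N := maxn 1 n; set X := 2 ^ E; set Y := 2 ^ _; set D := d.+1 ^ _.
move=> le; have := leq_mul (leqnn (1300 * (X * N))) le.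
by lia.
Qed.

Theorem theorem1p14 (idx : Type) (d m1 m2 l : idx -> nat)
    (F : forall i, (d i).-tuple bool -> (d i).-tuple bool -> bool)
    (P : forall i, protocol (d i) (m1 i) (m2 i) (l i))
    (hF : forall i, sigma2_computes (P i) (F i))
    (heff : efficient P) :
  exists (R : cmd) (c : nat),
  forall (i : idx) (n : nat) (I : instance n (d i)),
  exists J : (2 ^ m1 i).-tuple (instance n (2 ^ (m2 i + l i))),
    runs R (reduction_input (m1 i) (m2 i) (l i) I)
      (c * (maxn 1 n * 2 ^ (c * (m1 i + m2 i + l i)) * (d i).+1 ^ c))
      (reduction_output J) /\
    (satisfying_pair (F i) I <->
     exists j : 'I_(2 ^ m1 i), OV (tnth J j)).
Proof.
have [cA [cB [cV [k eff]]]] := heff.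
have [c hc] := cost_bound cA cB cV k.
exists (reduction cA cB cV), c => i n I; exists (insts (P i) I); split.
  by apply: runs_le (hc _ _ _ _ _) _; apply: runs_reduction; apply: eff.
exact: insts_correct (hF i).
Qed.
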